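(* Let $U \subseteq V$ be an immediate extension of DVRs having quotient fields $Q$ and $F$, respectively. There is a one-to-one correspondence between the bad stable rings $R$ with $U \subseteq R \subseteq V$ and normalization $V$, and the proper full $V$-submodules $K$ of $\Omega_{F/Q}$, given by $$R \mapsto \Omega(R) \quad\text{and}\quad K \mapsto V \cap d_{F/Q}^{-1}(K).$$
   Context: All rings are commutative with identity. A DVR is a rank one discrete valuation ring; $\mathfrak{M}_V$ denotes the maximal ideal of $V$. An extension of DVRs $U \subseteq V$ is immediate if $U$ and $V$ have the same value group and residue field; equivalently, $\mathfrak{M}_U \subseteq \mathfrak{M}_V$ and $V = U + \mathfrak{M}_U V$. The normalization of a ring is its integral closure in its total ring of quotients. An ideal $I$ of a ring $R$ is stable if $I$ is projective over its ring of endomorphisms; $R$ is a stable ring if every ideal of $R$ containing a nonzerodivisor is stable. A bad stable ring is a one-dimensional quasilocal (i.e. having a unique maximal ideal, not necessarily Noetherian) stable domain whose normalization is not a finitely generated module over it. $\Omega_{F/Q}$ is the module of Kähler differentials of $F/Q$ and $d_{F/Q}: F \to \Omega_{F/Q}$ is the exterior (universal) differential. For a ring $R$ with $U \subseteq R \subseteq V$, $\Omega(R) := \sum_{r \in R} V d_{F/Q}(r)$, a $V$-submodule of $\Omega_{F/Q}$. A submodule $K$ of a torsion-free module $L$ over a domain is full if $L/K$ is a torsion module. *)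

(* Defs.v *)
From HB Require Import structures.
From mathcomp Require Import all_boot all_order all_algebra.
From mathcomp Require Import all_classical.

Set Implicit Arguments.
Unset Strict Implicit.
Unset Printing Implicit Defensive.

Import GRing.Theory.

Local Open Scope classical_set_scope.
Local Open Scope ring_scope.

Section Endomorphisms.
Variables (R : pzRingType) (M : lmodType R).

Record endo := Endo { endo_fun :> M -> M; endo_linear : linear endo_fun }.

HB.instance Definition _ (f : endo) :=
  GRing.isLinear.Build R M M *:%R (endo_fun f) (endo_linear f).

Lemma endoP (f g : endo) : (forall x, f x = g x) -> f = g.
Proof.
case: f g => [f fL] [g gL] /= /funext fg.
by subst g; rewrite (Prop_irrelevance fL gL).
Qed.

HB.instance Definition _ := gen_eqMixin endo.
HB.instance Definition _ := gen_choiceMixin endo.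

Let endo0 : endo := Endo (linearP (\0 : {linear M -> M})).
Let endo1 : endo := Endo (linearP (idfun : {linear M -> M})).
Let endoN (f : endo) : endo := Endo (linearP (-%R \o f : {linear M -> M})).
Let endoD (f g : endo) : endo := Endo (linearP (f \+ g : {linear M -> M})).
Let endoM (f g : endo) : endo := Endo (linearP (f \o g : {linear M -> M})).

Let endoDA : associative endoD.
Proof. by move=> f g h; apply: endoP => x /=; rewrite addrA. Qed.
Let endoDC : commutative endoD.
Proof. by move=> f g; apply: endoP => x /=; rewrite addrC. Qed.
Let endo0D : left_id endo0 endoD.
Proof. by move=> f; apply: endoP => x /=; rewrite add0r. Qed.
Let endoND : left_inverse endo0 endoN endoD.
Proof. by move=> f; apply: endoP => x /=; rewrite addNr. Qed.

HB.instance Definition _ :=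
  GRing.isZmodule.Build endo endoDA endoDC endo0D endoND.

Let endoMA : associative endoM.
Proof. by move=> f g h; apply: endoP. Qed.
Let endo1M : left_id endo1 endoM.
Proof. by move=> f; apply: endoP. Qed.
Let endoM1 : right_id endo1 endoM.
Proof. by move=> f; apply: endoP. Qed.
Let endoMDl : left_distributive endoM +%R.
Proof. by move=> f g h; apply: endoP. Qed.
Let endoMDr : right_distributive endoM +%R.
Proof. by move=> f g h; apply: endoP => x /=; rewrite linearD. Qed.

HB.instance Definition _ :=
  GRing.Zmodule_isPzRing.Build endo endoMA endo1M endoM1 endoMDl endoMDr.

(* M as a left module over its endomorphism ring, f acting by x |-> f x. *)
Definition endo_module : Type := M.
HB.instance Definition _ := GRing.Zmodule.on endo_module.

Let endo_scale (f : endo) (x : endo_module) : endo_module := f x.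

Let endo_scaleA f g x : endo_scale f (endo_scale g x) = endo_scale (f * g) x.
Proof. by []. Qed.
Let endo_scale1 : left_id 1 endo_scale.
Proof. by []. Qed.
Let endo_scaleDr : right_distributive endo_scale +%R.
Proof. by move=> f x y; apply: linearD. Qed.
Let endo_scaleDl x : {morph endo_scale^~ x : f g / f + g}.
Proof. by []. Qed.

HB.instance Definition _ := GRing.Zmodule_isLmodule.Build endo endo_module
  endo_scaleA endo_scale1 endo_scaleDr endo_scaleDl.

End Endomorphisms.

Definition projective (S : pzRingType) (M : lmodType S) : Prop :=
  forall (N P : lmodType S) (g : {linear N -> P}) (f : {linear M -> P}),
    (forall p, exists n, g n = p) ->
    exists h : {linear M -> N}, forall m, g (h m) = f m.
Arguments projective S M : clear implicits.

Section Rings.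
Variable R : comNzRingType.

(* Arbitrary ideals of R are the R-submodules of R^o (the library's [idealr]
   structure only covers proper ideals). *)
Section IdealModule.
Variable I : submodClosed R^o.
Definition ideal_module : Type := {x : R^o | x \in I}.
HB.instance Definition _ := Choice.on ideal_module.
HB.instance Definition _ := SubType.on ideal_module.
HB.instance Definition _ := [SubChoice_isSubLmodule of ideal_module by <:].
End IdealModule.

Definition stable_ideal (I : submodClosed R^o) : Prop :=
  projective (endo (ideal_module I)) (endo_module (ideal_module I)).

Definition stable_ring : Prop :=
  forall I : submodClosed R^o,
    (exists2 x : R, x \in I & GRing.lreg x) -> stable_ideal I.

Definition maximal_ideal (M : idealr R) : Prop :=
  forall I : idealr R, {subset M <= I} -> {subset I <= M}.

Definition quasilocal : Prop :=
  exists2 M : idealr R, maximal_ideal M &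
    forall N : idealr R, maximal_ideal N -> N =i M.

Definition prime_chain n (P : 'I_n.+1 -> prime_idealr R) : Prop :=
  forall i j : 'I_n.+1, (i < j)%N ->
    {subset P i <= P j} /\ ~ {subset P j <= P i}.

Definition krull_dim n : Prop :=
  (exists P : 'I_n.+1 -> prime_idealr R, prime_chain P) /\
  ~ (exists P : 'I_n.+2 -> prime_idealr R, prime_chain P).

End Rings.

Section Subrings.
Variable F : fieldType.

Section Subring.
Variable A : subringClosed F.

Definition subring : Type := {x : F | x \in A}.
HB.instance Definition _ := Choice.on subring.
HB.instance Definition _ := SubType.on subring.
HB.instance Definition _ := [SubChoice_isSubComNzRing of subring by <:].

(* The quotient field of A, formed inside F. *)
Definition quotient_field : set F :=
  [set x | exists a b, [/\ a \in A, b \in A, b != 0 & x = a / b]].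

Definition subring_unit : set F := [set x | [/\ x \in A, x != 0 & x^-1 \in A]].

(* The union of the maximal ideals of A; this is the maximal ideal of A when A
   is quasilocal. *)
Definition maxideal : set F :=
  [set x | exists2 M : idealr subring, maximal_ideal M &
             exists2 y : subring, y \in M & x = val y].

Definition normalization : set F :=
  [set x | quotient_field x /\ integralOver (val : subring -> F) x].

Definition finitely_generated (N : set F) : Prop :=
  exists s : seq F,
    N = [set x | exists a : 'I_(size s) -> subring,
                   x = \sum_i val (a i) * s`_i].

Definition bad_stable : Prop :=
  [/\ krull_dim subring 1, quasilocal subring, stable_ring subring
    & ~ finitely_generated normalization].

(* v is a discrete valuation, normalized so that its value group is the whole
   of int; its values at 0 and outside the quotient field are irrelevant. *)
Definition dvr : Prop :=
  exists v : F -> int,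
  [/\ {in quotient_field &, forall x y, x != 0 -> y != 0 ->
         v (x * y) = v x + v y},
      {in quotient_field &, forall x y, x != 0 -> y != 0 -> x + y != 0 ->
         Num.min (v x) (v y) <= v (x + y)},
      (exists x, [/\ quotient_field x, x != 0 & v x = 1])
    & [set` A] = [set x | quotient_field x /\ (x = 0 \/ 0 <= v x)]].

End Subring.

(* The inclusion of A in B is local and induces isomorphisms of the residue
   fields A / maxideal A -> B / maxideal B and of the value groups
   K^* / A^* -> L^* / B^*, with K and L the quotient fields. *)
Definition immediate (A B : subringClosed F) : Prop :=
  [/\ {subset A <= B},
      (forall x, x \in A -> maxideal A x <-> maxideal B x),
      (forall y, y \in B -> exists2 x, x \in A & maxideal B (y - x)),
      (forall x, quotient_field A x -> x != 0 ->
         subring_unit A x <-> subring_unit B x)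
    & (forall y, quotient_field B y -> y != 0 ->
         exists x, [/\ quotient_field A x, x != 0 & subring_unit B (y / x)])].

End Subrings.

Section Kaehler.
Variables (F : fieldType) (Q : set F).

Definition derivation (M : lmodType F) (D : F -> M) : Prop :=
  [/\ forall x y, D (x + y) = D x + D y,
      forall x y, D (x * y) = x *: D y + y *: D x
    & forall q x, Q q -> D (q * x) = q *: D x].

(* (Omega, d) is the module of Kaehler differentials of F over Q, with its
   exterior differential. *)
Definition universal_derivation (Omega : lmodType F) (d : F -> Omega) : Prop :=
  derivation d /\
  forall (M : lmodType F) (D : F -> M), derivation D ->
    (exists f : {linear Omega -> M}, forall x, f (d x) = D x) /\
    (forall f g : {linear Omega -> M},
       (forall x, f (d x) = D x) -> (forall x, g (d x) = D x) -> f =1 g).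

(* Existence: Omega is the quotient of the formal sums of the a *: d b by the
   relations that hold for every derivation. *)
Section Existence.
Implicit Types s t : seq (F * F).

Let ev (M : lmodType F) (D : F -> M) s : M := \sum_(p <- s) p.1 *: D p.2.

Let kaehler_rel s t : bool :=
  `[< forall (M : lmodType F) (D : F -> M),
        derivation D -> ev D s = ev D t >].

Let kaehler_relP s t :
  reflect (forall (M : lmodType F) (D : F -> M),
             derivation D -> ev D s = ev D t)
          (kaehler_rel s t).
Proof. exact: asboolP. Qed.

Let kaehler_rel_refl : reflexive kaehler_rel.
Proof. by move=> s; apply/kaehler_relP. Qed.
Let kaehler_rel_sym : symmetric kaehler_rel.
Proof.
by move=> s t; apply/kaehler_relP/kaehler_relP => st M D DD; rewrite st.
Qed.
Let kaehler_rel_trans : transitive kaehler_rel.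
Proof.
move=> t s u /kaehler_relP st /kaehler_relP tu; apply/kaehler_relP => M D DD.
by rewrite st // tu.
Qed.

Let kaehler_equiv := EquivRel kaehler_rel kaehler_rel_refl kaehler_rel_sym
  kaehler_rel_trans.

Local Open Scope quotient_scope.

Definition kaehler : Type := {eq_quot kaehler_equiv}.
HB.instance Definition _ := Choice.on kaehler.
HB.instance Definition _ := EqQuotient.on kaehler.
Local Notation T := kaehler.
Let cls s : T := \pi_T s.

Let evr (M : lmodType F) (D : F -> M) (u : T) : M := ev D (repr u).

Let evrE (M : lmodType F) (D : F -> M) s : derivation D -> evr D (cls s) = ev D s.
Proof.
move=> DD; have /eqP : cls (repr (cls s)) = cls s by rewrite /cls reprK.
by rewrite eqmodE => /kaehler_relP; apply.
Qed.

Let evrP (u v : T) :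
  (forall (M : lmodType F) (D : F -> M),
     derivation D -> evr D u = evr D v) -> u = v.
Proof.
move=> uv; rewrite -[u]reprK -[v]reprK; apply/eqP; rewrite eqmodE.
by apply/kaehler_relP => M D /uv.
Qed.

Let scale_seq (a : F) s := [seq (a * p.1, p.2) | p <- s].
Let k0 : T := cls [::].
Let kD (u v : T) : T := cls (repr u ++ repr v).
Let kZ (a : F) (u : T) : T := cls (scale_seq a (repr u)).
Let kN (u : T) : T := kZ (- 1) u.

Let evr0 (M : lmodType F) (D : F -> M) : derivation D -> evr D k0 = 0.
Proof. by move=> DD; rewrite evrE // /ev big_nil. Qed.
Let evrD (M : lmodType F) (D : F -> M) u v :
  derivation D -> evr D (kD u v) = evr D u + evr D v.
Proof. by move=> DD; rewrite evrE // /ev big_cat. Qed.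
Let evrZ (M : lmodType F) (D : F -> M) a u : derivation D -> evr D (kZ a u) = a *: evr D u.
Proof.
move=> DD; rewrite evrE // /ev big_map scaler_sumr.
by apply: eq_bigr => p _; rewrite scalerA.
Qed.
Let evrN (M : lmodType F) (D : F -> M) u : derivation D -> evr D (kN u) = - evr D u.
Proof. by move=> DD; rewrite evrZ // scaleN1r. Qed.

Let kDA : associative kD.
Proof. by move=> u v w; apply: evrP => M D DD; rewrite !evrD // addrA. Qed.
Let kDC : commutative kD.
Proof. by move=> u v; apply: evrP => M D DD; rewrite !evrD // addrC. Qed.
Let k0D : left_id k0 kD.
Proof. by move=> u; apply: evrP => M D DD; rewrite evrD // evr0 // add0r. Qed.
Let kND : left_inverse k0 kN kD.
Proof.
by move=> u; apply: evrP => M D DD; rewrite evrD // evrN // evr0 // addNr.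
Qed.

HB.instance Definition _ := GRing.isZmodule.Build T kDA kDC k0D kND.

Let kZA a b (u : T) : kZ a (kZ b u) = kZ (a * b) u.
Proof. by apply: evrP => M D DD; rewrite !evrZ // scalerA. Qed.
Let kZ1 : left_id 1 (kZ : F -> T -> T).
Proof. by move=> u; apply: evrP => M D DD; rewrite evrZ // scale1r. Qed.
Let kZDr : right_distributive (kZ : F -> T -> T) +%R.
Proof.
move=> a u v; apply: evrP => M D DD.
by rewrite (evrZ _ _ DD) (evrD _ _ DD) (evrD _ _ DD) !evrZ // scalerDr.
Qed.
Let kZDl (u : T) : {morph (kZ^~ u : F -> T) : a b / a + b}.
Proof.
move=> a b; apply: evrP => M D DD.
by rewrite (evrZ _ _ DD) (evrD _ _ DD) !evrZ // scalerDl.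
Qed.

HB.instance Definition _ :=
  GRing.Zmodule_isLmodule.Build F T kZA kZ1 kZDr kZDl.

Lemma universal_derivation_exists :
  exists (Omega : lmodType F) (d : F -> Omega), universal_derivation d.
Proof.
pose d x : T := cls [:: (1, x)].
have evd (M : lmodType F) (D : F -> M) x : derivation D -> evr D (d x) = D x.
  by move=> DD; rewrite evrE // /ev big_seq1 scale1r.
exists T, d; split.
  split=> [x y|x y|q x Qq]; apply: evrP => M D DD; have [DA DM DQ] := DD.
  - by rewrite (evrD _ _ DD) !evd.
  - by rewrite (evrD _ _ DD) !(evrZ _ _ DD) !evd.
  - by rewrite (evrZ _ _ DD) !evd // DQ.
move=> M D DD; split.
  have lin : linear (evr D : T -> M).
    by move=> a u v; rewrite (evrD _ _ DD) (evrZ _ _ DD).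
  pose f := GRing.isLinear.Build F T M *:%R (evr D : T -> M) lin.
  pose g : {linear T -> M} := HB.pack (evr D : T -> M) f.
  by exists g => x; apply: evd.
move=> f g fd gd u.
have -> : u = \sum_(p <- repr (u : T)) p.1 *: d p.2 :> T.
  apply: evrP => N E EE.
  rewrite /evr -/(ev E _) [in LHS]/ev.
  elim: (repr u) => [|p s IHs]; first by rewrite !big_nil -/(evr E _) evr0.
  rewrite !big_cons -/(evr E _) (evrD _ _ EE) (evrZ _ _ EE) evd //.
  by rewrite IHs.
by rewrite !linear_sum; apply: eq_bigr => p _; rewrite !linearZ fd gd.
Qed.

End Existence.

End Kaehler.

Section Correspondence.
Variables (F : fieldType) (V : subringClosed F) (Omega : lmodType F).
Variable d : F -> Omega.

Definition Omega_of (R : set F) : set Omega :=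
  [set w | exists s : seq (F * F),
             (forall p, p \in s -> p.1 \in V /\ R p.2) /\
             w = \sum_(p <- s) p.1 *: d p.2].

Definition ring_of (K : set Omega) : set F := [set` V] `&` d @^-1` K.

Definition submodule (K : set Omega) : Prop :=
  [/\ K 0, (forall u w, K u -> K w -> K (u + w))
    & forall a w, a \in V -> K w -> K (a *: w)].

(* Omega / K is a torsion V-module. *)
Definition full (K : set Omega) : Prop :=
  forall w, exists a, [/\ a \in V, a != 0 & K (a *: w)].

Definition proper_full_submodules : set (set Omega) :=
  [set K | [/\ submodule K, K <> setT & full K]].

Definition bad_stable_between (U : subringClosed F) : set (set F) :=
  [set R | exists A : subringClosed F,
     [/\ R = [set` A], {subset U <= A}, {subset A <= V}, bad_stable A
       & normalization A = [set` V]]].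

End Correspondence.

Arguments proper_full_submodules {F} V Omega.

(* Main.v *)
Require Import Defs.
From HB Require Import structures.
From mathcomp Require Import all_boot all_order all_algebra.
From mathcomp Require Import all_classical.
From mathcomp Require Import zify ring.

Set Implicit Arguments.
Unset Strict Implicit.
Unset Printing Implicit Defensive.

Import GRing.Theory Num.Theory.

Local Open Scope classical_set_scope.
Local Open Scope ring_scope.

(** Let Q and F be the quotient fields of U and V. Since U and V have the same value
    group and residue field, a uniformizer t of U is one of V, and every element of F
    is approximated t-adically by elements of Q: F = Q + t^n V for all n
    ([unif_dense]). The differential d kills Q, so d F = d (t^n V), and modulo a full
    submodule K of Omega a product a *: d x only depends on a up to t^n V for some n.
    Replacing a by a nearby q in Q turns a *: d x into d (q * x).

    From K to R = V `&` d @^-1` K. This approximation gives Omega = d V + K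
    ([differential_cover]), hence Omega(R) = K. For x, y in V with approximations u, u'
    in U, the element x * y - u' * x - u * y has its differential in K. Thus
    V is a quadratic extension of R: x * y lies in R + R x + R y ([quadratic]). Also
    V / R is torsion. These two facts make R bad stable ([quadratic_bad_stable]): V is
    integral over R and the only primes are 0 and the trace of tV. A nonzero ideal has
    the form x J with x of least value and R <= J <= V, quadraticity makes J a ring,
    and so the ideal is free of rank one over its endomorphism ring. Finite generation
    of V would give t^n V <= R for some n, and then Omega = d (t^n V) + K = K.

    From R to Omega(R). Clearing denominators shows that Omega(R) is full; the point
    is that v in V with d v in Omega(R) lies in R, which also gives properness
    because R <> V. Stability enters through the ideals R `&` t^c V: projectivity,
    tested on one explicit surjection, shows that such an ideal is t^c times a
    ring ([stable_blowup]). This multiplicativity is exactly what makes the rule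
      x |-> (f |-> class of q * x in F / (Q + R), where q in Q is close to f)
    a well-defined Q-derivation of F into the F-module of additive maps from F to
    F / (Q + R). It factors through d. At f = 1 it sends v to the class of v, and it
    sends a *: d r to 0 when a is in V and r in R; so d v in Omega(R) forces
    v in (Q + R) `&` V = R ([ring_of_Omega_of_sub]). *)

(** * Stable ideals *)

Section StableIdeals.
Variables (R : comNzRingType) (I : submodClosed R^o).
Local Notation M := (ideal_module I).
Local Notation E := (endo M).
Implicit Types (x y z : M) (e f : E).

Let homothety_linear (r : R) : linear (fun x : M => r *: x : M).
Proof. by move=> a x y; rewrite scalerDr !scalerA mulrC. Qed.

Definition homothety r : E := Endo (homothety_linear r).

(** An endomorphism of an ideal behaves like the multiplication by a fraction: both
    sides are the value of [e] at the product of [x] and [y]. In particular [e] is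
    determined by its value at one regular element. *)
Lemma endo_crossC e x y : val x * val (e y) = val y * val (e x).
Proof.
have: e ((val x : R) *: y) = e ((val y : R) *: x).
  by congr (e _); apply: val_inj; exact: (mulrC (val x : R)).
by rewrite !linearZ => /(congr1 val).
Qed.

(** The ideal is then free of rank one over its endomorphism ring: the endomorphism
    taking [x] to [y] is unique because [x] is regular. *)
Lemma cyclic_stable_ideal (x : M) : GRing.lreg (val x) ->
  (forall y, exists e, e x = y) -> stable_ideal I.
Proof.
move=> regx cycx N P g f gsurj.
have [coef coefP] : {coef : M -> E & forall y, coef y x = y}.
  by exists (fun y => sval (cid (cycx y))) => y; case: cid.
have uniqE e e' : e x = e' x -> e = e'.
  move=> ee'; apply: endoP => y; apply: val_inj; apply: regx.
  by rewrite !(endo_crossC _ x y) ee'.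
have [n gn] := gsurj (f (x : endo_module M)).
have lin : linear (fun y : endo_module M => coef y *: n).
  move=> e y z; rewrite scalerA -scalerDl; congr (_ *: _).
  apply: uniqE; rewrite coefP /=.
  by rewrite -[RHS]/(e (coef y x) + coef z x) !coefP.
have [h hE] : exists h : {linear endo_module M -> N},
    forall y, h y = coef y *: n.
  pose m := GRing.isLinear.Build E (endo_module M) N *:%R _ lin.
  pose h : {linear endo_module M -> N} := HB.pack (fun y => coef y *: n) m.
  by exists h.
exists h => y; rewrite hE linearZ gn -linearZ; congr (f _).
exact: coefP.
Qed.

(** Projectivity is tested against the surjection E + B -> I, (e, b) |-> e x + b,
    where B is an E-submodule with I = R x + B. The two components of a section are
    multiplications by fractions summing to 1. *)
Section Split.
Variable B : {pred endo_module M}.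
Hypothesis B0 : 0 \in B.
Hypothesis BD : forall b c, b \in B -> c \in B -> b + c \in B.
Hypothesis BE : forall e b, b \in B -> e *: b \in B.

Let B_submod : submod_closed B.
Proof. by split=> // e b c bB cB; apply: BD => //; apply: BE. Qed.
HB.instance Definition _ :=
  GRing.isSubmodClosed.Build E (endo_module M) B B_submod.
Definition split_summand : Type := {b : endo_module M | b \in B}.
HB.instance Definition _ := Choice.on split_summand.
HB.instance Definition _ := SubType.on split_summand.
HB.instance Definition _ := [SubChoice_isSubLmodule of split_summand by <:].

(** Here [e] is the E-component of the section at [x], and [e'] its E-component at [y];
    they are related because x *: y = y *: x. *)
Lemma stable_ideal_split (x : M) : stable_ideal I ->
    (forall y, exists r : R, (y - r *: x : endo_module M) \in B) ->
  exists e : E, (x - e x : endo_module M) \in B /\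
    forall y, exists e', forall z, val x * val (e' z) = val y * val (e z).
Proof.
move=> stI gen.
pose gf (u : E^o * split_summand) : endo_module M :=
  (u.1 : E) *: (x : endo_module M) + val u.2.
have lin : linear gf.
  move=> e [f b] [f' b']; rewrite /gf /= scalerDl scalerDr -scalerA.
  by rewrite -!addrA; congr (_ + _); rewrite addrCA.
have [g gE] : exists g : {linear (E^o * split_summand)%type -> endo_module M},
    forall u, g u = gf u.
  pose m := GRing.isLinear.Build E (E^o * split_summand)%type
    (endo_module M) *:%R _ lin.
  pose g : {linear (E^o * split_summand)%type -> endo_module M} := HB.pack gf m.
  by exists g.
have gsurj y : exists u, g u = y.
  have [r rB] := gen y.
  pose u : (E^o * split_summand)%type :=
    (homothety r, exist (fun b => b \in B) _ rB).
  exists u.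
  by rewrite gE /gf; exact: (etrans (addrC _ _) (subrK (r *: (x : M)) y)).
have [h hE] := stI _ _ g idfun gsurj.
exists (h x).1; split.
  have := hE x; rewrite gE /gf /= => {1}<-.
  rewrite -[(h x).1 x]/((h x).1 *: (x : endo_module M)) addrC addKr.
  exact: (valP (h x).2).
move=> y; exists (h y).1 => z.
have : homothety (val x) *: h y = homothety (val y) *: h x.
  rewrite -!linearZ; congr (h _).
  by apply: val_inj; exact: (mulrC (val x : R)).
by move=> /(congr1 fst) /= /(congr1 (fun e : E => val (e z))).
Qed.
End Split.

End StableIdeals.

(** * Integral elements and their inverses *)

Section Integral.
Variables (F : fieldType) (A : subringClosed F).

(** Dividing the integral equation of x, of degree n, by x^(n-1) expresses x as a
    polynomial in x^-1 with coefficients in A; hence x lies in every ring P that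
    contains A and x^-1. *)
Lemma integral_inv_mem (P : F -> Prop) x :
    (forall a, a \in A -> P a) -> (forall a b, P a -> P b -> P (a + b)) ->
    (forall a b, P a -> P b -> P (a * b)) ->
  integralOver (val : subring A -> F) x -> P x^-1 -> P x.
Proof.
move=> PA PD PM [p pmon /rootP]; rewrite horner_coef.
rewrite (size_map_inj_poly val_inj) //.
have coefE i : (map_poly (val : subring A -> F) p)`_i = val p`_i.
  by rewrite coef_map_id0.
have := pmon; rewrite monicE lead_coefE.
case szp: (size p) => [|n].
  by move/eqP: szp (monic_neq0 pmon); rewrite size_poly_eq0 => ->.
move=> /eqP/= pn; rewrite big_ord_recr /= coefE pn mul1r => pE Px.
have [->|x0] := eqVneq x 0; first by apply: PA; apply: rpred0.
case: n szp pn pE => [|n] szp pn pE; rewrite ?szp.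
  by move: pE; rewrite big_ord0 expr0 add0r => /eqP; rewrite oner_eq0.
have -> : x = - \sum_(i < n.+1) val p`_i * x^-1 ^+ (n - i).
  apply: (mulIf (expf_neq0 n x0)); rewrite -exprS mulNr mulr_suml.
  apply/eqP; rewrite -addr_eq0 addrC; apply/eqP; rewrite -[RHS]pE.
  congr (_ + _); apply: eq_bigr => i _; rewrite coefE -mulrA; congr (_ * _).
  rewrite -[in X in _ * X](subnK (leq_ord i)) exprD mulrA -exprMn mulVf //.
  by rewrite expr1n mul1r.
have PN a : P a -> P (- a).
  by move=> Pa; rewrite -mulN1r; apply: PM => //; apply: PA; rewrite rpredN rpred1.
apply: PN; apply: (big_ind P) => //; first by apply: PA; apply: rpred0.
move=> i _; apply: (PM); first by apply: PA; apply: valP.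
by elim: (n - i)%N => [|k IH]; [apply: PA; apply: rpred1 | rewrite exprS; apply: PM].
Qed.

Lemma quadratic_integral a b x : a \in A -> b \in A -> x ^+ 2 = a * x + b ->
  integralOver (val : subring A -> F) x.
Proof.
move=> aA bA xx; pose a' : subring A := Sub a aA; pose b' : subring A := Sub b bA.
exists ('X^2 - (a' *: 'X + b'%:P)).
  rewrite monicE lead_coefDl ?lead_coefXn // size_polyXn size_polyN.
  by rewrite -mul_polyC size_MXaddC; case: ifP => // _; rewrite size_polyC; case: eqP.
have [f fE] : exists f : {rmorphism subring A -> F}, f = val :> (subring A -> F).
  by exists val.
rewrite -fE /root rmorphB /= map_polyXn rmorphD /= map_polyZ map_polyX map_polyC.
by rewrite /= fE !hornerE /= xx subrr.
Qed.
End Integral.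

(** * Uniformizers of immediate extensions *)

Section QuotientField.
Variables (F : fieldType) (A : subringClosed F).
Local Notation Q := (quotient_field A).

Lemma quotient_fieldW x : x \in A -> Q x.
Proof.
by move=> xA; exists x, 1; split; rewrite ?rpred1 ?oner_eq0 ?divr1.
Qed.

Lemma quotient_fieldM x y : Q x -> Q y -> Q (x * y).
Proof.
move=> [a [b [aA bA b0 ->]]] [c [e [cA eA e0 ->]]].
by exists (a * c), (b * e); split; rewrite ?rpredM ?mulf_neq0 ?mulf_div.
Qed.

Lemma quotient_fieldV x : Q x -> Q x^-1.
Proof.
move=> [a [b [aA bA b0 ->]]]; rewrite invf_div.
have [->|a0] := eqVneq a 0; last by exists b, a.
by rewrite invr0 mulr0; apply: quotient_fieldW; rewrite rpred0.
Qed.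

Lemma quotient_fieldN x : Q x -> Q (- x).
Proof.
by rewrite -mulN1r; apply: quotient_fieldM; apply: quotient_fieldW; rewrite rpredN1.
Qed.

Lemma quotient_fieldD x y : Q x -> Q y -> Q (x + y).
Proof.
move=> [a [b [aA bA b0 ->]]] [c [e [cA eA e0 ->]]].
exists (a * e + c * b), (b * e); split; rewrite ?mulf_neq0 ?addf_div //.
  by rewrite rpredD ?rpredM.
by rewrite rpredM.
Qed.

Lemma quotient_fieldX x n : Q x -> Q (x ^+ n).
Proof.
move=> Qx; elim: n => [|n IH]; first by apply: quotient_fieldW; rewrite rpred1.
by rewrite exprS; apply: quotient_fieldM.
Qed.

Lemma dvr_valuation : dvr A -> exists v : F -> int,
  [/\ forall x y, Q x -> Q y -> x != 0 -> y != 0 -> v (x * y) = v x + v y,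
      exists t, [/\ Q t, t != 0 & v t = 1]
    & forall x, x != 0 -> x \in A <-> Q x /\ 0 <= v x].
Proof.
move=> [v [vM _ vt Av]]; exists v; split=> // [x y Qx Qy|x x0].
  by apply: vM; rewrite inE.
have -> : (x \in A) = [set` A] x :> Prop by [].
by rewrite Av; split=> [[Qx [/eqP|//]]|[Qx vx]]; [rewrite (negPf x0)|split=> //; right].
Qed.

End QuotientField.

(** The consequences of immediateness that the correspondence rests on. [unif_exp],
    [unif_val] and [unif_nunit] say that V is a rank one valuation ring of F with
    maximal ideal t V, [unif_res] is U + t V = V and [unif_cap] is Q `&` V = U. *)
Record uniformizer (F : fieldType) (U V : subringClosed F) (t : F) : Prop := {
  unif_sub : {subset U <= V};
  unif_mem : t \in U;
  unif_neq0 : t != 0;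
  unif_cap : forall x, quotient_field U x -> x \in V -> x \in U;
  unif_res : forall x, x \in V -> exists2 u, u \in U & (x - u) / t \in V;
  unif_exp : forall x, exists n, t ^+ n * x \in V;
  unif_val : forall x, x / t \in V \/ x^-1 \in V;
  unif_nunit : t^-1 \notin V }.

Lemma maxideal_nunit (F : fieldType) (A : subringClosed F) x :
  maxideal A x -> x \in A /\ (x != 0 -> x^-1 \notin A).
Proof.
move=> [M _ [y yM ->]]; split=> [|y0]; first exact: valP.
apply/negP => yA; pose z : subring A := Sub (val y)^-1 yA.
have := idealr1 M; have -> : 1 = z * y by apply: val_inj; rewrite /= mulVf.
by rewrite idealMr.
Qed.

(** An element t of value 1 for U also has value 1 for V: an element of Q that has
    value 1 for V, which exists as the value groups agree, is a power of t times a
    unit of U, so the value of t for V divides 1. *)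
Lemma immediate_uniformizer (F : fieldType) (U V : subringClosed F) :
    dvr U -> dvr V -> quotient_field V = setT -> immediate U V ->
  exists t, uniformizer U V t.
Proof.
move=> /dvr_valuation[v [vM [t [Qt t0 vt]] Uv]].
move=> /dvr_valuation[w [wM' [p [_ p0 wp]] Vw']].
move=> QV [UV mUV resUV unitUV valUV].
have wM x y : x != 0 -> y != 0 -> w (x * y) = w x + w y.
  by apply: wM'; rewrite QV.
have Vw x : x != 0 -> (x \in V) = (0 <= w x).
  by move=> x0; apply/idP/idP => [/(Vw' _ x0)[]|wx] //; apply/(Vw' _ x0); rewrite QV.
have w1 : w 1 = 0.
  by apply: (addrI (w 1)); rewrite -wM ?oner_eq0 // mulr1 addr0.
have wV x : x != 0 -> w x^-1 = - w x.
  by move=> x0; apply: (addrI (w x)); rewrite -wM ?invr_eq0 // divff // w1 subrr.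
have wX x n : x != 0 -> w (x ^+ n) = w x *+ n.
  move=> x0; elim: n => [|n IH]; first by rewrite expr0 w1.
  by rewrite exprS wM ?expf_neq0 // IH mulrS.
have Q1 : quotient_field U 1 by apply: quotient_fieldW; rewrite rpred1.
have v1 : v 1 = 0.
  by apply: (addrI (v 1)); rewrite -vM ?oner_eq0 // mulr1 addr0.
have vV x : quotient_field U x -> x != 0 -> v x^-1 = - v x.
  move=> Qx x0; apply: (addrI (v x)).
  by rewrite -vM ?invr_eq0 // ?divff // ?v1 ?subrr //; apply: quotient_fieldV.
have vX x n : quotient_field U x -> x != 0 -> v (x ^+ n) = v x *+ n.
  move=> Qx x0; elim: n => [|n IH]; first by rewrite expr0 v1.
  rewrite exprS vM ?expf_neq0 // ?IH ?mulrS //; exact: quotient_fieldX.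
have tU : t \in U by apply/Uv; rewrite ?vt.
have v0w0 x : quotient_field U x -> x != 0 -> v x = 0 -> w x = 0.
  move=> Qx x0 vx.
  have : x \in V by apply: UV; apply/Uv; rewrite ?vx.
  have : x^-1 \in V.
    apply: UV; apply/Uv; rewrite ?invr_eq0 // vV ?vx //; split=> //.
    exact: quotient_fieldV.
  by rewrite !Vw ?invr_eq0 // wV //; lia.
have vw x : quotient_field U x -> x != 0 -> w x = v x * w t.
  move=> Qx x0.
  case vx: (v x) => [n|n].
    have: w (x / t ^+ n) = 0.
      apply: v0w0.
      - apply: quotient_fieldM => //; apply: quotient_fieldV.
        exact: quotient_fieldX.
      - by rewrite mulf_neq0 ?invr_eq0 ?expf_neq0.
      rewrite vM ?invr_eq0 ?expf_neq0 ?vV ?expf_neq0 ?vX ?vt ?vx //;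
        try apply: quotient_fieldV; try exact: quotient_fieldX.
      by lia.
    rewrite wM ?invr_eq0 ?expf_neq0 // wV ?expf_neq0 // wX //.
    by rewrite -mulr_natl; lia.
  have: w (x * t ^+ n.+1) = 0.
    apply: v0w0; first by apply: quotient_fieldM => //; apply: quotient_fieldX.
      by rewrite mulf_neq0 ?expf_neq0.
    rewrite vM ?expf_neq0 ?vX ?vt ?vx //; try exact: quotient_fieldX.
    by lia.
  rewrite wM ?expf_neq0 // wX //.
  by rewrite -mulr_natl; lia.
have wt : w t = 1.
  have wt0 : 0 <= w t by rewrite -Vw // UV.
  have [x [Qx x0 [px px0 xp]]] := valUV p ltac:(by rewrite QV) p0.
  have wx : w x = 1.
    have := px; rewrite Vw // wM ?invr_eq0 // wV // wp.
    have := xp; rewrite invf_div Vw ?mulf_neq0 ?invr_eq0 // wM ?invr_eq0 // wV // wp.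
    lia.
  move: wx; rewrite vw // => /(congr1 absz) /eqP; rewrite abszM muln_eq1.
  by move=> /andP[_ /eqP]; lia.
exists t; split=> //.
- move=> x Qx; have [->|x0] := eqVneq x 0; first by rewrite !rpred0.
  by rewrite Vw // vw // wt mulr1 => vx; apply/(Uv _ x0).
- move=> y yV; have [x xU /maxideal_nunit[zV zV']] := resUV y yV.
  exists x => //; have [->|z0] := eqVneq (y - x) 0; first by rewrite mul0r rpred0.
  move: zV (zV' z0); rewrite (Vw _ z0) Vw ?invr_eq0 // wV // => wz wz'.
  rewrite Vw ?mulf_neq0 ?invr_eq0 // wM ?invr_eq0 // wV // wt.
  by lia.
- move=> x; have [->|x0] := eqVneq x 0; first by exists 0%N; rewrite mulr0 rpred0.
  exists `|w x|%N; rewrite Vw ?mulf_neq0 ?expf_neq0 // wM ?expf_neq0 // wX // wt.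
  by lia.
- move=> x; have [->|x0] := eqVneq x 0; first by left; rewrite mul0r rpred0.
  have [wx|wx] := lerP (w x) 0.
    by right; rewrite Vw ?invr_eq0 // wV //; lia.
  by left; rewrite Vw ?mulf_neq0 ?invr_eq0 // wM ?invr_eq0 // wV // wt; lia.
by rewrite Vw ?invr_eq0 // wV // wt.
Qed.

Section Uniformizer.
Variables (F : fieldType) (U V : subringClosed F) (t : F).
Hypothesis tP : uniformizer U V t.
Local Notation Q := (quotient_field U).

Lemma unifX_neq0 n : t ^+ n != 0.
Proof. by rewrite expf_neq0 // (unif_neq0 tP). Qed.

Lemma unifX_mem n : t ^+ n \in U.
Proof. by rewrite rpredX // (unif_mem tP). Qed.

Lemma unifX_memV n : t ^+ n \in V.
Proof. by rewrite (unif_sub tP) ?unifX_mem. Qed.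

Lemma unif_divXW m n x : (m <= n)%N -> x / t ^+ n \in V -> x / t ^+ m \in V.
Proof.
move=> mn xn; have -> : x / t ^+ m = x / t ^+ n * t ^+ (n - m).
  rewrite -{1}(subnK mn) exprD.
  have := unifX_neq0 m; have := unifX_neq0 (n - m).
  by move=> ? ?; field; apply/andP.
by rewrite rpredM ?unifX_memV.
Qed.

Lemma unif_approxV n x : x \in V -> exists2 u, u \in U & (x - u) / t ^+ n \in V.
Proof.
move=> xV; elim: n => [|n [u uU zV]]; first by exists 0; rewrite ?rpred0 ?subr0 ?divr1.
have [u' u'U z'V] := unif_res tP zV.
exists (u + t ^+ n * u'); first by rewrite rpredD ?rpredM ?unifX_mem.
have -> // : (x - (u + t ^+ n * u')) / t ^+ n.+1 = ((x - u) / t ^+ n - u') / t.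
have := unifX_neq0 n; have := unif_neq0 tP => ? ?.
by rewrite exprS; field; apply/andP.
Qed.

Lemma unif_dense n x : exists2 q, Q q & (x - q) / t ^+ n \in V.
Proof.
have [m mV] := unif_exp tP x; have [u uU zV] := unif_approxV (m + n) mV.
exists (u / t ^+ m).
  apply: quotient_fieldM; first exact: quotient_fieldW.
  by apply: quotient_fieldV; apply: quotient_fieldW; apply: unifX_mem.
have -> // : (x - u / t ^+ m) / t ^+ n = (t ^+ m * x - u) / t ^+ (m + n).
have := unifX_neq0 n; have := unifX_neq0 m => ? ?.
by rewrite exprD; field; apply/andP.
Qed.

Lemma unif_divV x : x / t \in V -> x \in V.
Proof.
by move=> xV; rewrite -(divfK (unif_neq0 tP) x) rpredM // -[t]expr1 unifX_memV.
Qed.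

Lemma unif_invV x : x / t \notin V -> x != 0 /\ x^-1 \in V.
Proof.
move=> xt; split; last by case: (unif_val tP x) xt => // ->.
by apply: contraNneq xt => ->; rewrite mul0r rpred0.
Qed.

Lemma unif_1sub x : (1 - x) / t \in V -> [/\ x \in V, x != 0 & x^-1 \in V].
Proof.
move=> xt; have [|x0 xV] := @unif_invV x; last split=> //.
  apply: contra (unif_nunit tP) => xV.
  by rewrite -div1r -(subrK x 1) mulrDl rpredD.
by rewrite -[x](subKr 1) rpredB ?rpred1 // unif_divV.
Qed.

Lemma unif_prime x y : x * y / t \in V -> x / t \in V \/ y / t \in V.
Proof.
move=> xy; have [|xt] := boolP (x / t \in V); [by left | right].
have [x0 xV] := unif_invV xt.
by rewrite -(mulKf x0 y) -mulrA rpredM.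
Qed.

Lemma unif_int_closed (A : subringClosed F) x : {subset A <= V} ->
  integralOver (val : subring A -> F) x -> x \in V.
Proof.
move=> AV xint; have [|xV] := unif_val tP x; first exact: unif_divV.
apply: (integral_inv_mem (P := fun y => y \in V) AV _ _ xint xV) => a b *.
  by rewrite rpredD.
by rewrite rpredM.
Qed.

(** V is a quadratic extension of A and V / A is torsion: an elementwise form of
    being bad stable, up to the possibility that some t^n V lies in A. *)
Record quadratic (A : subringClosed F) : Prop := {
  quad_sub : {subset U <= A};
  quad_subV : {subset A <= V};
  quad_tors : forall x, x \in V -> exists n, t ^+ n * x \in A;
  quad_mul : forall x y, x \in V -> y \in V ->
    exists a b, [/\ a \in A, b \in A & x * y - a * x - b * y \in A] }.

(** * Quadratic extensions are bad stable *)

Section Quadratic.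
Variable A : subringClosed F.
Hypothesis qA : quadratic A.
Local Notation R := (subring A).
Local Notation inR := (exist (fun a => a \in A) _).
Let UA := quad_sub qA.
Let AV := quad_subV qA.
Let tXA n : t ^+ n \in A.
Proof. by rewrite UA ?unifX_mem. Qed.

Lemma quad_tors2 x : exists n, t ^+ n * x \in A.
Proof.
have [n xV] := unif_exp tP x; have [m mA] := quad_tors qA xV.
by exists (m + n)%N; rewrite exprD -mulrA.
Qed.

Lemma quad_sqr x : x \in V -> exists a b, [/\ a \in A, b \in A & x ^+ 2 = a * x + b].
Proof.
move=> xV; have [a [b [aA bA cA]]] := quad_mul qA xV xV.
exists (a + b), (x * x - a * x - b * x); split=> //; first exact: rpredD.
by ring.
Qed.

(** The inverse is quadratic over A, so it is a polynomial in x. *)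
Lemma quad_unit x : x \in A -> x^-1 \in V -> x^-1 \in A.
Proof.
move=> xA /quad_sqr[a [b [aA bA xx]]].
apply: (integral_inv_mem (A := A) (P := fun y => y \in A)) => //; rewrite ?invrK //.
- by move=> c d *; rewrite rpredD.
- by move=> c d *; rewrite rpredM.
exact: quadratic_integral xx.
Qed.

(** A + A x contains all powers of x, and one power of t maps A + A x into A. *)
Lemma quad_pow x : x \in V -> exists n, forall k, t ^+ n * x ^+ k \in A.
Proof.
move=> xV; have [n nA] := quad_tors qA xV; exists n => k.
have [a [b [aA bA xx]]] := quad_sqr xV.
have [c [e [cA eA ->]]] : exists c e, [/\ c \in A, e \in A & x ^+ k = c * x + e].
  elim: k => [|k [c [e [cA eA xk]]]].
    by exists 0, 1; rewrite rpred0 rpred1 mul0r add0r.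
  exists (c * a + e), (c * b); split; rewrite ?rpredD ?rpredM //.
  by rewrite exprS xk mulrDr mulrCA -expr2 xx; ring.
by rewrite mulrDr mulrCA rpredD // rpredM.
Qed.

Lemma quad_fraction x : quotient_field A x.
Proof.
have [n nA] := quad_tors2 x; exists (t ^+ n * x), (t ^+ n); split=> //.
  exact: unifX_neq0.
by rewrite mulrC mulKf ?unifX_neq0.
Qed.

Lemma quad_normalization : normalization A = [set` V].
Proof.
apply/seteqP; split=> x /=.
  by move=> [_]; apply: unif_int_closed AV.
move=> xV; split; first exact: quad_fraction.
have [a [b [aA bA xx]]] := quad_sqr xV.
exact: quadratic_integral xx.
Qed.

(** Finitely many generators of V are carried into A by a single power of t. *)
Lemma quad_infinite :
  ~ (exists n, forall x, x \in V -> t ^+ n * x \in A) ->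
  ~ finitely_generated A (normalization A).
Proof.
rewrite quad_normalization => inf [s sV]; apply: inf.
have [n nA] : exists n, forall i : 'I_(size s), t ^+ n * s`_i \in A.
  elim: {sV}s => [|x s [n nA]]; first by exists 0%N; case.
  have [m mA] := quad_tors2 x.
  exists (m + n)%N; case; case=> [|i] /= lti.
    by rewrite addnC exprD -mulrA rpredM.
  by rewrite exprD -mulrA rpredM //; exact: (nA (Ordinal (lti : (i < size s)%N))).
exists n => x xV; have : [set` V] x by [].
rewrite sV => -[a ->]; rewrite mulr_sumr rpred_sum // => i _.
by rewrite mulrCA rpredM //; exact: valP.
Qed.

Lemma quad_maxideal :
  exists M : prime_idealr R, forall x : R, (x \in M) = (val x / t \in V).
Proof.
pose m : R -> bool := fun x => val x / t \in V.
have mE x : (x \in m) = (val x / t \in V) by [].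
have mI : idealr_closed m.
  split=> [||a u v]; rewrite !mE.
  - by rewrite /= mul0r rpred0.
  - by rewrite /= div1r (unif_nunit tP).
  - move=> uM vM; rewrite /= mulrDl -mulrA rpredD // rpredM // AV //.
    exact: (valP a).
have mP : prime_idealr_closed m.
  by move=> u v; rewrite !mE /= => /unif_prime[]->; rewrite ?orbT.
pose f := isIdealr.Build R m mI.
pose g := isPrimeIdealrClosed.Build R m mP.
by pose M : prime_idealr R := HB.pack m f g; exists M.
Qed.

Lemma quad_zeroideal :
  exists Z : prime_idealr R, forall x : R, (x \in Z) = (x == 0).
Proof.
pose m : R -> bool := fun x => x == 0.
have mE x : (x \in m) = (x == 0) by [].
have mI : idealr_closed m.
  split=> [||a u v]; rewrite !mE ?eqxx ?oner_eq0 //.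
  by move=> /eqP-> /eqP->; rewrite mulr0 addr0.
have mP : prime_idealr_closed m.
  move=> u v; rewrite !mE => /eqP/(congr1 val)/eqP.
  by rewrite /= mulf_eq0 => /orP[/eqP u0|/eqP v0]; apply/orP; [left|right];
    apply/eqP; apply: val_inj.
pose f := isIdealr.Build R m mI.
pose g := isPrimeIdealrClosed.Build R m mP.
by pose M : prime_idealr R := HB.pack m f g; exists M.
Qed.

(** An element of A outside t V is a unit of A, by [quad_unit]. *)
Lemma quad_ideal_sub (I : idealr R) (x : R) : x \in I -> val x / t \in V.
Proof.
move=> xI; apply/negPn/negP => /unif_invV[x0 xV].
have xA := quad_unit (valP x) xV; have := idealr1 I.
have -> : 1 = (inR xA : R) * x by apply: val_inj; rewrite /= mulVf.
by rewrite idealMr.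
Qed.

(** A nonzero prime contains t because V / A is torsion: some power of t is a multiple
    of z. If x = t v with v in V, a power of x is t times an element of A, by
    [quad_pow]. *)
Lemma quad_prime (P : prime_idealr R) (z : R) : z \in P -> z != 0 ->
  forall x : R, (x \in P) = (val x / t \in V).
Proof.
move=> zP z0 x; apply/idP/idP; first exact: (quad_ideal_sub (I := P)).
have primeX (y : R) n : y ^+ n \in P -> y \in P.
  elim: n => [|n IH]; first by rewrite expr0 (idealr1 P).
  by rewrite exprS prime_idealrM => /orP[].
pose t' : R := inR (UA (unif_mem tP)).
have valX (y : R) n : val (y ^+ n) = val y ^+ n.
  by elim: n => // n IH; rewrite !exprS /= IH.
have tP' : t' \in P.
  have [n nA] := quad_tors2 (val z)^-1; apply: (primeX _ n).
  have -> : t' ^+ n = (inR nA : R) * z.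
    by apply: val_inj; rewrite valX /= divfK.
  exact: idealMr.
move=> xV; have [n nA] := quad_pow xV; apply: (primeX _ n.+1).
have -> : x ^+ n.+1 = (inR (nA n.+1) : R) * t'.
  apply: val_inj; rewrite valX /= -{1}(divfK (unif_neq0 tP) (val x)) exprMn.
  by rewrite [t ^+ n.+1]exprS; ring.
exact: idealMr.
Qed.

Lemma quad_quasilocal : quasilocal R.
Proof.
have [M MP] := quad_maxideal.
have Mmax : maximal_ideal M by move=> I _ x /quad_ideal_sub; rewrite MP.
exists M => // N Nmax x; apply/idP/idP; first by move/quad_ideal_sub; rewrite MP.
by apply: (Nmax M) => y /quad_ideal_sub; rewrite MP.
Qed.

Lemma quad_dim1 : krull_dim R 1.
Proof.
have [M MP] := quad_maxideal; have [Z ZP] := quad_zeroideal.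
pose t' : R := inR (UA (unif_mem tP)).
split.
  exists (fun i : 'I_2 => if i == ord0 then Z else M).
  case=> [[|[|//]]] ilt; case=> [[|[|//]]] jlt //= _; split=> [x|].
    by rewrite ZP MP => /eqP->; rewrite mul0r rpred0.
  move=> /(_ t'); rewrite MP ZP /= divff ?(unif_neq0 tP) ?rpred1 // => /(_ isT).
  by move=> /eqP/(congr1 val) /= t0; case/eqP: (unif_neq0 tP).
move=> [P chP].
have [_] := chP ord0 (inord 1) ltac:(by rewrite inordK).
move=> /existsNP[z /not_implyP[zP1 zP0]].
have z0 : z != 0 by apply/eqP => z0; apply: zP0; rewrite z0; apply: idealr0.
have [P12 P21] := chP (inord 1) (inord 2) ltac:(by rewrite !inordK).
apply: P21 => x; rewrite (quad_prime (P12 _ zP1) z0) => xV.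
by rewrite (quad_prime zP1 z0).
Qed.

Lemma val_ideal_linear (I : submodClosed R^o) (a : R) (x y : ideal_module I) :
  val (val (a *: x + y) : R) = val a * val (val x : R) + val (val y : R).
Proof.
have -> : val (a *: x + y) = a *: (val x : R^o) + val y by exact: linearP.
have -> : a *: (val x : R^o) = a * (val x : R) by [].
rewrite -(rmorphM (val : R -> F)).
exact: (rmorphD (val : R -> F)).
Qed.

Lemma multiplier_endo (I : submodClosed R^o) (g : F) :
    (forall z : R, z \in I -> exists2 w : R, w \in I & val w = g * val z) ->
  exists e : endo (ideal_module I), forall z, val (val (e z)) = g * val (val z).
Proof.
move=> gI.
have [e eP] : {e : ideal_module I -> ideal_module I &
    forall z, val (val (e z)) = g * val (val z)}.
  have ex (z : ideal_module I) : exists w : ideal_module I,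
      val (val w) = g * val (val z).
    by have [w wI we] := gI _ (valP z); exists (exist (fun b => b \in I) w wI).
  by exists (fun z => sval (cid (ex z))) => z; case: cid.
have lin : linear e.
  move=> a x y; apply: val_inj; apply: val_inj; rewrite eP.
  by rewrite !val_ideal_linear !eP mulrCA -mulrDr.
by exists (Endo lin).
Qed.

(** If x has least value in I, then I = x J with A <= J <= V, and quadraticity of V
    over A makes J closed under products. So J acts on I, and I = J x is cyclic over
    its endomorphisms. *)
Lemma quad_stable : stable_ring R.
Proof.
move=> I [r rI rreg].
have r0 : val r != 0.
  apply/eqP => r0.
  have /eqP := rreg 1 0 ltac:(by apply: val_inj; rewrite /= r0 !mul0r).
  by rewrite oner_eq0.
(* The value of x is the least n such that t^n is a multiple of x in V. *)
pose small n := `[< exists x : R, [/\ x \in I, val x != 0 & t ^+ n / val x \in V] >].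
have [n0 n0P] : exists n, small n.
  by have [n nV] := unif_exp tP (val r)^-1; exists n; apply/asboolP; exists r.
case: (ex_minnP (ex_intro _ n0 n0P)) => n /asboolP[x [xI x0 xV]] nmin.
have xmin (y : R) : y \in I -> val y / val x \in V.
  move=> yI; have [yx|] := boolP (val x / val y / t \in V); last first.
    by move=> /unif_invV[_]; rewrite invf_div.
  have [y0|y0] := eqVneq (val y) 0; first by rewrite y0 mul0r rpred0.
  have : t ^+ n / val y / t \in V.
    have -> : t ^+ n / val y / t = t ^+ n / val x * (val x / val y / t).
      by field; rewrite x0 y0 (unif_neq0 tP).
    by rewrite rpredM.
  case: n nmin {xV} => [_|n nmin]; rewrite ?exprS => yV.
    case/negP: (unif_nunit tP); have -> : t^-1 = t ^+ 0 / val y / t * val y.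
      by rewrite expr0; field; rewrite y0 (unif_neq0 tP).
    by rewrite rpredM // AV //; exact: (valP y).
  suff /nmin : small n by rewrite ltnn.
  apply/asboolP; exists y; split=> //.
  have <- // : t * t ^+ n / val y / t = t ^+ n / val y.
  by field; rewrite y0 (unif_neq0 tP).
pose xm : ideal_module I := exist (fun b => b \in I) x xI.
apply: (cyclic_stable_ideal (x := xm)).
  move=> a b /(congr1 val) /= ab; apply: val_inj; exact: (mulfI x0).
move=> y; have yI := valP y.
have [|e eP] := @multiplier_endo I (val (val y) / val x).
  move=> z zI; have := quad_mul qA (xmin _ yI) (xmin _ zI).
  move=> [a [b [aA bA cA]]].
  have wI : (inR aA : R) *: (val y : R^o) + ((inR bA : R) *: (z : R^o)
      + (inR cA : R) *: (x : R^o)) \in I.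
    by apply: rpredD; [|apply: rpredD]; apply: rpredZ.
  exists ((inR aA : R) * (val y : R) + ((inR bA : R) * z + (inR cA : R) * x)).
    exact: wI.
  by rewrite /=; field.
exists e; apply: val_inj; apply: val_inj; rewrite eP.
exact: divfK.
Qed.

Lemma quadratic_bad_stable :
  ~ (exists n, forall x, x \in V -> t ^+ n * x \in A) -> bad_stable A.
Proof.
move=> inf; split; [exact: quad_dim1 | exact: quad_quasilocal | exact: quad_stable |].
exact: quad_infinite.
Qed.

End Quadratic.
End Uniformizer.

(** * From submodules of differentials to rings *)

Section Span.
Variables (F : fieldType) (Q : set F) (Omega : lmodType F) (d : F -> Omega).
Hypothesis univ_d : universal_derivation Q d.

Section Submodule.
Variable S : submodClosed Omega.
Definition span_module : Type := {w : Omega | w \in S}.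
HB.instance Definition _ := Choice.on span_module.
HB.instance Definition _ := SubType.on span_module.
HB.instance Definition _ := [SubChoice_isSubLmodule of span_module by <:].

(** As a derivation into S, d factors through itself by a linear map h into S; by
    uniqueness h followed by the inclusion of S is the identity of Omega. *)
Lemma differential_submodT : (forall x, d x \in S) -> forall w, w \in S.
Proof.
move=> dS w; have [[dD dM dQ] univ] := univ_d.
pose D x : span_module := exist (fun w => w \in S) _ (dS x).
have DD : derivation Q D.
  split=> [x y|x y|q x Qq]; apply: val_inj; [exact: dD | exact: dM | exact: dQ].
have [[h hd] _] := univ span_module D DD.
have [_ /(_ idfun (val \o h : {linear Omega -> Omega}))] :=
  univ Omega d (And3 dD dM dQ).
have hE x : (val \o h) (d x) = d x by rewrite /= hd.
by move=> /(_ (fun=> erefl) hE w) /= ->; exact: (valP (h w)).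
Qed.
End Submodule.

Lemma differential_spanT w :
  exists s : seq (F * F), w = \sum_(p <- s) p.1 *: d p.2.
Proof.
pose m : {pred Omega} :=
  fun w => `[< exists s : seq (F * F), w = \sum_(p <- s) p.1 *: d p.2 >].
have mS : submod_closed m.
  split=> [|a u v]; first by apply/asboolP; exists [::]; rewrite big_nil.
  move=> /asboolP[s ->] /asboolP[s' ->]; apply/asboolP.
  exists ([seq (a * p.1, p.2) | p <- s] ++ s').
  rewrite big_cat big_map scaler_sumr; congr (_ + _).
  by apply: eq_bigr => p _; rewrite scalerA.
pose f := GRing.isSubmodClosed.Build F Omega m mS.
pose S : submodClosed Omega := HB.pack (m : Omega -> bool) f.
apply/asboolP; apply: (@differential_submodT S) => x.
by apply/asboolP; exists [:: (1, x)]; rewrite big_seq1 scale1r.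
Qed.
End Span.

Section Differentials.
Variables (F : fieldType) (U V : subringClosed F) (t : F).
Hypothesis tP : uniformizer U V t.
Local Notation Q := (quotient_field U).
Variables (Omega : lmodType F) (d : F -> Omega).
Hypothesis univ_d : universal_derivation Q d.

Let dD x y : d (x + y) = d x + d y. Proof. by case: univ_d => -[]. Qed.
Let dM x y : d (x * y) = x *: d y + y *: d x. Proof. by case: univ_d => -[]. Qed.
Let dZ q x : Q q -> d (q * x) = q *: d x.
Proof. by case: univ_d => -[_ _ dQ _] /dQ. Qed.

Lemma differential_const q : Q q -> d q = 0.
Proof.
move=> Qq; rewrite -[q]mulr1 dZ //; have := dM 1 1.
rewrite mulr1 !scale1r => d1.
by rewrite (_ : d 1 = 0) ?scaler0 //; apply: (addrI (d 1)); rewrite -d1 addr0.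
Qed.

Let d0 : d 0 = 0.
Proof. by apply: differential_const; apply: quotient_fieldW; rewrite rpred0. Qed.

Let dN x : d (- x) = - d x.
Proof. by apply: (addrI (d x)); rewrite -dD !subrr. Qed.

(** Since d kills Q and F = Q + t^n V, each differential comes from t^n V. *)
Lemma differential_near x n : exists2 y, y \in V & d x = d (t ^+ n * y).
Proof.
have [q Qq yV] := unif_dense tP n x; exists ((x - q) / t ^+ n) => //.
by rewrite mulrC divfK ?(unifX_neq0 tP) // dD dN (differential_const Qq) subr0.
Qed.

Section OmegaOf.
Variable R : set F.

Lemma Omega_of_submodule : submodule V (Omega_of V d R).
Proof.
split.
- by exists [::]; rewrite big_nil.
- move=> u w [s [sR ->]] [s' [s'R ->]]; exists (s ++ s'); rewrite big_cat; split=> //.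
  by move=> p; rewrite mem_cat => /orP[/sR|/s'R].
move=> a w aV [s [sR ->]]; exists [seq (a * p.1, p.2) | p <- s]; split.
  by move=> _ /mapP[p /sR[pV pR] ->]; rewrite /= rpredM.
by rewrite big_map scaler_sumr; apply: eq_bigr => p _; rewrite scalerA.
Qed.

Lemma Omega_of_gen a r : a \in V -> R r -> Omega_of V d R (a *: d r).
Proof.
move=> aV Rr; exists [:: (a, r)]; rewrite big_seq1; split=> // p.
by rewrite inE => /eqP->.
Qed.

Lemma Omega_of_min K : submodule V K -> (forall r, R r -> K (d r)) ->
  Omega_of V d R `<=` K.
Proof.
move=> [K0 KD KZ] RK w [s [sR ->]]; rewrite big_seq; apply: (big_ind K) => //.
by move=> p /sR[pV /RK]; apply: KZ.
Qed.
End OmegaOf.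

Section RingOf.
Variable K : set Omega.
Hypotheses (subK : submodule V K) (fullK : full V K).

Let K0 : K 0. Proof. by case: subK. Qed.
Let KD u w : K u -> K w -> K (u + w). Proof. by case: subK => _ + _; apply. Qed.
Let KZ a w : a \in V -> K w -> K (a *: w). Proof. by case: subK => _ _; apply. Qed.
Let KN w : K w -> K (- w). Proof. by rewrite -scaleN1r; apply: KZ; rewrite rpredN1. Qed.

Lemma full_exp w : exists n, K (t ^+ n *: w).
Proof.
have [a [aV a0 Kaw]] := fullK w.
have [n nV] := unif_exp tP a^-1; exists n.
by rewrite -(divfK a0 (t ^+ n)) -scalerA; apply: KZ.
Qed.

Let scale_exp n a w : a / t ^+ n \in V -> K (t ^+ n *: w) -> K (a *: w).
Proof. by move=> aV Kw; rewrite -(divfK (unifX_neq0 tP n) a) -scalerA; apply: KZ. Qed.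

Let ringp : F -> bool := fun x => `[< ring_of V d K x >].
Let ring_closed : subring_closed ringp.
Proof.
split.
- apply/asboolP; split; rewrite /= ?rpred1 // differential_const //.
  by apply: quotient_fieldW; rewrite rpred1.
- move=> x y /asboolP[/= xV Kx] /asboolP[/= yV Ky]; apply/asboolP; split=> /=.
    exact: rpredB.
  by rewrite dD dN; apply: KD => //; apply: KN.
move=> x y /asboolP[/= xV Kx] /asboolP[/= yV Ky]; apply/asboolP; split=> /=.
  exact: rpredM.
by rewrite dM; apply: KD; apply: KZ.
Qed.

Lemma ring_of_subring : exists A : subringClosed F, [set` A] = ring_of V d K.
Proof.
pose f := GRing.isSubringClosed.Build F ringp ring_closed.
pose A : subringClosed F := HB.pack ringp f.
by exists A; apply/seteqP; split=> x /asboolP.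
Qed.

(** For a term a *: d v with v in V, choose n with t^n *: d v in K, so that t^n v is in
    the ring, and write a = q + t^n b with q in Q and b in V. Then a *: d v is the sum
    of d (q v) and of b *: d (t^n v), and q v may be moved into V modulo Q. *)
Lemma differential_cover w :
  exists2 y, y \in V & Omega_of V d (ring_of V d K) (w - d y).
Proof.
have [s ->] := differential_spanT univ_d w.
have [O0 OD OZ] := Omega_of_submodule (ring_of V d K).
elim: s => [|[a x] s [y yV IH]].
  by exists 0; rewrite ?rpred0 // big_nil d0 subrr.
have [v vV dx] := differential_near x 0; rewrite mul1r in dx.
have [n Kv] := full_exp (d v).
have [q Qq bV] := unif_dense tP n a.
have [z zV dz] := differential_near (q * v) 0; rewrite mul1r in dz.
exists (z + y); first exact: rpredD.
rewrite big_cons /= dD opprD addrACA; apply: OD => //.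
rewrite dx -dz dZ // -scalerBl -{1}(divfK (unifX_neq0 tP n) (a - q)) -scalerA.
rewrite -dZ; last by apply: quotient_fieldW; apply: (unifX_mem tP).
apply: Omega_of_gen => //; split=> /=; first by rewrite rpredM ?(unifX_memV tP).
by rewrite dZ //; apply: quotient_fieldW; apply: (unifX_mem tP).
Qed.

Lemma Omega_of_ring_of : Omega_of V d (ring_of V d K) = K.
Proof.
have OK : Omega_of V d (ring_of V d K) `<=` K by apply: Omega_of_min => // r [].
apply/seteqP; split=> // w Kw; have [y yV Oy] := differential_cover w.
rewrite -[w](subrK (d y)).
have [_ OD _] := Omega_of_submodule (ring_of V d K); apply: OD => //.
rewrite -[d y]scale1r; apply: Omega_of_gen; rewrite ?rpred1 //; split=> //=.
by rewrite -[d y](subKr w); apply: KD => //; apply: KN; apply: OK.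
Qed.

(** If u, u' in U are close to x, y in V, the differential of x y - u' x - u y is
    (x - u) *: d y + (y - u') *: d x, which lies in K. *)
Lemma ring_of_quadratic (A : subringClosed F) :
  [set` A] = ring_of V d K -> quadratic U V t A.
Proof.
move=> AK; have AP x : (x \in A) <-> (x \in V) /\ K (d x).
  by have -> : (x \in A) = [set` A] x :> Prop by []; rewrite AK.
split.
- move=> u uU; apply/AP; split; first exact: (unif_sub tP).
  by rewrite differential_const //; apply: quotient_fieldW.
- by move=> x /AP[].
- move=> x xV; have [n nK] := full_exp (d x); exists n; apply/AP.
  rewrite rpredM ?(unifX_memV tP) // dZ //.
  by apply: quotient_fieldW; apply: (unifX_mem tP).
move=> x y xV yV.
have [n Kx] := full_exp (d x); have [m Ky] := full_exp (d y).
have [u uU uV] := unif_approxV tP m xV.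
have [u' u'U u'V] := unif_approxV tP n yV.
have UA r : r \in U -> r \in A.
  move=> rU; apply/AP; split; first exact: (unif_sub tP).
  by rewrite differential_const //; apply: quotient_fieldW.
exists u', u; split; [exact: UA | exact: UA | apply/AP; split].
  by rewrite !rpredB ?rpredM // (unif_sub tP).
rewrite dD dD !dN dM !dZ; try exact: quotient_fieldW.
have -> : x *: d y + y *: d x - u' *: d x - u *: d y
    = (x - u) *: d y + (y - u') *: d x.
  rewrite !scalerBl -!addrA; congr (_ + _).
  by rewrite addrC -!addrA addrC -!addrA.
by apply: KD; [apply: scale_exp Ky | apply: scale_exp Kx].
Qed.

(** Otherwise d (t^n V) lies in K, but it covers Omega modulo K. *)
Lemma ring_of_infinite (A : subringClosed F) : K <> setT ->
  [set` A] = ring_of V d K -> ~ (exists n, forall x, x \in V -> t ^+ n * x \in A).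
Proof.
move=> KT AK [n nA]; apply: KT; apply/seteqP; split=> // w _.
have [y yV Oy] := differential_cover w.
rewrite -[w](subrK (d y)); apply: KD; first by rewrite -Omega_of_ring_of.
have [z zV ->] := differential_near y n.
have : [set` A] (t ^+ n * z) by exact: nA.
by rewrite AK => -[].
Qed.

End RingOf.

Lemma ring_of_bad_stable K : proper_full_submodules V Omega K ->
  bad_stable_between V U (ring_of V d K).
Proof.
move=> [subK KT fullK]; have [A AK] := ring_of_subring subK.
have qA := ring_of_quadratic subK fullK AK.
exists A; split=> //; [exact: (quad_sub qA) | exact: (quad_subV qA) | |].
  exact: (quadratic_bad_stable tP qA (ring_of_infinite subK fullK KT AK)).
exact: (quad_normalization tP).
Qed.

End Differentials.

(** * Ideals of a stable ring *)

Section Stable.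
Variables (F : fieldType) (U V : subringClosed F) (t : F).
Hypothesis tP : uniformizer U V t.
Variable A : subringClosed F.
Hypotheses (UA : {subset U <= A}) (AV : {subset A <= V}).
Hypothesis normA : normalization A = [set` V].
Local Notation R := (subring A).

Let tXA n : t ^+ n \in A.
Proof. by rewrite UA ?(unifX_mem tP). Qed.
Let tX0 n : t ^+ n != 0 := unifX_neq0 tP n.

Let intV x : x \in V -> integralOver (val : R -> F) x.
Proof. by move=> xV; have : normalization A x; [rewrite normA | case]. Qed.

(** If b in A is nonzero, t^l / b lies in V for some l, so it is integral over A, while
    its inverse lies in the localization of A at the powers of t. Hence t^l / b lies
    there too, by [integral_inv_mem]: every denominator may be taken to be a power
    of t. *)
Lemma normalization_tors x : exists n, t ^+ n * x \in A.
Proof.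
have [k kV] := unif_exp tP x.
have [] : normalization A (t ^+ k * x) by rewrite normA.
move=> [a [b [aA bA b0 xab]]] _; have [l lV] := unif_exp tP b^-1.
(* the localization of A at the powers of t *)
pose P y := exists m, t ^+ m * y \in A.
have PA c : c \in A -> P c by move=> cA; exists 0%N; rewrite mul1r.
have PD c e : P c -> P e -> P (c + e).
  move=> [m mA] [n nA]; exists (m + n)%N; rewrite mulrDr rpredD //.
    by rewrite addnC exprD -mulrA rpredM.
  by rewrite exprD -mulrA rpredM.
have PM c e : P c -> P e -> P (c * e).
  by move=> [m mA] [n nA]; exists (m + n)%N; rewrite exprD mulrACA rpredM.
have [|m mA] := integral_inv_mem PA PD PM (intV lV).
  by exists l; rewrite invf_div mulrC divfK.
exists (m + l + k)%N.
have -> : t ^+ (m + l + k) * x = t ^+ m * (t ^+ l / b) * a.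
  by rewrite !exprD -mulrA xab; field.
by rewrite rpredM.
Qed.

Hypothesis stA : stable_ring R.

(** Let I be the trace of t^c V on A, E its endomorphism ring and B the trace of
    t^(c+1) V. As V = U + t V, I = A t^c + B. Splitting E + B -> I gives g with
    1 - g in t V, so that g is a unit of V, and a g is in E for all a in t^-c I.
    As g is in E and its inverse is integral over A, this inverse is in E; so
    t^-c I = E is a ring. *)
Lemma stable_blowup c a b : a \in V -> b \in V ->
  t ^+ c * a \in A -> t ^+ c * b \in A -> t ^+ c * (a * b) \in A.
Proof.
move=> aV bV aA bA.
(* m and I are the ideal A `&` t^c V, and x is its element t^c. *)
pose m : {pred R^o} := fun z : R => val z / t ^+ c \in V.
have mE (z : R) : (z \in m) = (val z / t ^+ c \in V) by [].
have mS : submod_closed m.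
  split=> [|r u v]; rewrite !mE; first by rewrite /= mul0r rpred0.
  by move=> uV vV; rewrite /= mulrDl -mulrA rpredD // rpredM // AV //; exact: (valP r).
pose f := GRing.isSubmodClosed.Build R R^o m mS.
pose I : submodClosed R^o := HB.pack (m : R^o -> bool) f.
have IE (z : R) : (z \in I) = (val z / t ^+ c \in V) by [].
pose tc : R := exist (fun r => r \in A) _ (tXA c).
have tcI : tc \in I by rewrite IE /= divff ?rpred1.
pose x : ideal_module I := exist (fun r => r \in I) tc tcI.
pose B : {pred endo_module (ideal_module I)} :=
  fun y : ideal_module I => val (val y : R) / t ^+ c.+1 \in V.
have BP (y : ideal_module I) : (y \in B) = (val (val y : R) / t ^+ c.+1 \in V) by [].
have endoE (e : endo (ideal_module I)) y :
    val (val (e y) : R) = val (val (e x) : R) / t ^+ c * val (val y : R).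
  have /(congr1 val) /= := endo_crossC e x y.
  move=> exy; apply: (mulfI (tX0 c)); rewrite exy; by field.
have B0 : 0 \in B by rewrite BP /= mul0r rpred0.
have BD y z : y \in B -> z \in B -> y + z \in B.
  by rewrite !BP /= mulrDl; apply: rpredD.
have BE (e : endo (ideal_module I)) y : y \in B -> e *: y \in B.
  rewrite !BP => yB; rewrite -[e *: y]/(e y) endoE.
  rewrite -mulrA rpredM //; exact: (valP (e x)).
have stI : stable_ideal I.
  apply: stA; exists tc => //.
  by move=> u v /(congr1 val) /= uv; apply: val_inj; apply: (mulfI (tX0 c)).
have gen (y : ideal_module I) :
    exists r : R, (y - r *: x : endo_module (ideal_module I)) \in B.
  have yV : val (val y : R) / t ^+ c \in V := valP y.
  have [u uU uV] := unif_res tP yV.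
  exists (exist (fun r => r \in A) u (UA uU)); rewrite BP /=.
  have -> // : (val (val y) - u * t ^+ c) / t ^+ c.+1
      = (val (val y) / t ^+ c - u) / t.
  by rewrite exprS; field; rewrite tX0 (unif_neq0 tP).
have [e [ex eP]] := stable_ideal_split B0 BD BE stI gen.
pose g := val (val (e x) : R) / t ^+ c.
have [|gV g0 gV'] := @unif_1sub _ _ _ _ tP g.
  move: ex; rewrite BP /=.
  have -> // : (t ^+ c - val (val (e x))) / t ^+ c.+1 = (1 - g) / t.
  by rewrite /g exprS; field; rewrite tX0 (unif_neq0 tP).
(* J is I as a subset of F, and P is its ring of multipliers in F. *)
pose J z := z \in A /\ z / t ^+ c \in V.
pose P h := forall z, J z -> J (h * z).
have JI z : J z -> exists y : ideal_module I, val (val y : R) = z.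
  move=> [zA zV]; pose z' : R := exist (fun r => r \in A) z zA.
  by exists (exist (fun r => r \in I) z' zV).
have IJ (y : ideal_module I) : J (val (val y : R)).
  by split; [exact: (valP (val y)) | exact: (valP y)].
have PA r : r \in A -> P r.
  by move=> rA z [zA zV]; split; [|rewrite -mulrA]; rewrite rpredM // AV.
have PD r s : P r -> P s -> P (r + s).
  move=> Pr Ps z Jz; have [rA rV] := Pr z Jz; have [sA sV] := Ps z Jz.
  by split; rewrite mulrDl ?rpredD // mulrDl rpredD.
have PM r s : P r -> P s -> P (r * s).
  by move=> Pr Ps z Jz; rewrite -mulrA; apply: Pr; apply: Ps.
have Pg : P g by move=> z /JI[y <-]; rewrite -endoE; exact: IJ.
have Pg' : P g^-1.
  by apply: (integral_inv_mem PA PD PM); [exact: intV | rewrite invrK].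
have Pa : P (a * g).
  have [|y ya] := JI (t ^+ c * a); first by split; rewrite // mulrC mulKf.
  have [e' e'P] := eP y; move=> z /JI[z' zz'].
  have -> : a * g * z = val (val (e' z') : R).
    have eq : t ^+ c * val (val (e' z') : R)
        = val (val y : R) * val (val (e z') : R).
      exact: (congr1 val (e'P z')).
    by apply: (mulfI (tX0 c)); rewrite eq endoE -/g ya zz'; ring.
  exact: IJ.
have [|bA' _] := PM _ _ Pa Pg' (t ^+ c * b).
  by split; rewrite // mulrC mulKf.
by move: bA'; rewrite mulfK // mulrCA.
Qed.

End Stable.

(** * A derivation with values in additive maps *)

(** The F-module coinduced from the abelian group W: F acts on the argument. *)
Section AdditiveMaps.
Variables (F : comNzRingType) (W : zmodType).

Record addmap := AddMap { addmap_fun :> F -> W;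
  addmapD : forall x y, addmap_fun (x + y) = addmap_fun x + addmap_fun y }.

Lemma addmapP (f g : addmap) : (forall x, f x = g x) -> f = g.
Proof.
case: f g => [f fD] [g gD] /= /funext fg.
by subst g; rewrite (Prop_irrelevance fD gD).
Qed.

HB.instance Definition _ := gen_eqMixin addmap.
HB.instance Definition _ := gen_choiceMixin addmap.

Let zeroD (x y : F) : 0 = 0 + 0 :> W. Proof. by rewrite addr0. Qed.
Let oppD (f : addmap) x y : - f (x + y) = - f x + - f y.
Proof. by rewrite addmapD opprD. Qed.
Let addD (f g : addmap) x y : f (x + y) + g (x + y) = f x + g x + (f y + g y).
Proof. by rewrite !addmapD addrACA. Qed.
Let scaleD (a : F) (f : addmap) x y : f (a * (x + y)) = f (a * x) + f (a * y).
Proof. by rewrite mulrDr addmapD. Qed.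

Let add f g := AddMap (addD f g).
Let opp f := AddMap (oppD f).
Let zero := AddMap zeroD.
Let scale a f := AddMap (scaleD a f).

Let addmA : associative add.
Proof. by move=> f g h; apply: addmapP => x /=; rewrite addrA. Qed.
Let addmC : commutative add.
Proof. by move=> f g; apply: addmapP => x /=; rewrite addrC. Qed.
Let add0m : left_id zero add.
Proof. by move=> f; apply: addmapP => x /=; rewrite add0r. Qed.
Let addNm : left_inverse zero opp add.
Proof. by move=> f; apply: addmapP => x /=; rewrite addNr. Qed.

HB.instance Definition _ := GRing.isZmodule.Build addmap addmA addmC add0m addNm.

Let scalemA a b f : scale a (scale b f) = scale (a * b) f.
Proof. by apply: addmapP => x /=; rewrite mulrCA mulrA. Qed.
Let scale1m : left_id 1 scale.
Proof. by move=> f; apply: addmapP => x /=; rewrite mul1r. Qed.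
Let scalemDr : right_distributive scale +%R.
Proof. by move=> a f g; apply: addmapP. Qed.
Let scalemDl f : {morph scale^~ f : a b / a + b}.
Proof. by move=> a b; apply: addmapP => x /=; rewrite mulrDl addmapD. Qed.

HB.instance Definition _ :=
  GRing.Zmodule_isLmodule.Build F addmap scalemA scale1m scalemDr scalemDl.

Lemma addmap_sum I (s : seq I) (f : I -> addmap) x :
  (\sum_(i <- s) f i) x = \sum_(i <- s) f i x.
Proof. by elim: s => [|i s IH]; rewrite ?big_nil // !big_cons -IH. Qed.
End AdditiveMaps.

Section Derivation.
Variables (F : fieldType) (U V : subringClosed F) (t : F).
Hypothesis tP : uniformizer U V t.
Local Notation Q := (quotient_field U).
Variable A : subringClosed F.
Hypotheses (UA : {subset U <= A}) (AV : {subset A <= V}).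
Hypothesis torsA : forall x, exists n, t ^+ n * x \in A.
Hypothesis blowupA : forall c a b, a \in V -> b \in V ->
  t ^+ c * a \in A -> t ^+ c * b \in A -> t ^+ c * (a * b) \in A.

Let tX0 n : t ^+ n != 0 := unifX_neq0 tP n.
Let Qt n : Q (t ^+ n).
Proof. by apply: quotient_fieldW; apply: (unifX_mem tP). Qed.

Let Sp : F -> bool := fun x => `[< exists q r, [/\ Q q, r \in A & x = q + r] >].
Let S_closed : zmod_closed Sp.
Proof.
split; first by apply/asboolP; exists 0, 0; rewrite addr0 rpred0; split=> //;
  apply: quotient_fieldW; rewrite rpred0.
move=> _ _ /asboolP[q [r [Qq rA ->]]] /asboolP[q' [r' [Qq' rA' ->]]].
apply/asboolP; exists (q - q'), (r - r'); split; last by rewrite opprD addrACA.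
  by apply: quotient_fieldD => //; apply: quotient_fieldN.
by rewrite rpredB.
Qed.
Let S : zmodClosed F := HB.pack Sp (GRing.isZmodClosed.Build F Sp S_closed).
Let W : zmodType := {ideal_quot S}.
Let cls (x : F) : W := \pi_({ideal_quot S})%qT x.

Let clsD x y : cls (x + y) = cls x + cls y. Proof. exact: raddfD. Qed.
Let clsN x : cls (- x) = - cls x. Proof. exact: raddfN. Qed.
Let cls_eq0 x : cls x = 0 <-> exists q r, [/\ Q q, r \in A & x = q + r].
Proof.
have c0 : cls 0 = 0 by exact: raddf0.
have xS : (x \in S) = (cls x == 0).
  by rewrite -c0 -{1}[x]subr0; exact: Quotient.idealrBE.
split=> [/eqP|xqr]; first by rewrite -xS => /asboolP.
by apply/eqP; rewrite -xS; apply/asboolP.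
Qed.
Let clsA r : r \in A -> cls r = 0.
Proof.
move=> rA; apply/cls_eq0; exists 0, r; rewrite add0r; split=> //.
by apply: quotient_fieldW; rewrite rpred0.
Qed.

(* Multiplication by x maps the elements of Q that lie in t^(lev x) V into A, so the
   class of q * x only depends on q modulo t^(lev x) V. *)
Let lev x := sval (cid (torsA x)).
Let levP x : t ^+ lev x * x \in A. Proof. exact: svalP (cid (torsA x)). Qed.

Let approx n f := sval (cid2 (unif_dense tP n f)).
Let approxQ n f : Q (approx n f). Proof. by rewrite /approx; case: cid2. Qed.
Let approxP n f : (f - approx n f) / t ^+ n \in V.
Proof. by rewrite /approx; case: cid2. Qed.

Let pairing f x : W := cls (approx (lev x) f * x).

Let pairingE n f x q : (lev x <= n)%N -> Q q -> (f - q) / t ^+ n \in V ->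
  pairing f x = cls (q * x).
Proof.
move=> xn Qq /(unif_divXW tP xn) qV; apply/eqP.
rewrite -subr_eq0 -clsN -clsD; apply/eqP.
rewrite -mulrBl; apply: clsA; set p := approx _ _.
have -> : (p - q) * x = (p - q) / t ^+ lev x * (t ^+ lev x * x) by field.
rewrite rpredM // UA //; apply: (unif_cap tP).
  apply: quotient_fieldM; last by apply: quotient_fieldV.
  by apply: quotient_fieldD; [exact: approxQ | exact: quotient_fieldN].
have -> : (p - q) / t ^+ lev x = (f - q) / t ^+ lev x - (f - p) / t ^+ lev x by ring.
by rewrite rpredB // approxP.
Qed.

Let pairingDl x f g : pairing (f + g) x = pairing f x + pairing g x.
Proof.
rewrite [pairing f x]/pairing [pairing g x]/pairing -clsD -mulrDl.
apply: (@pairingE (lev x)) => //; first exact: quotient_fieldD.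
by rewrite opprD addrACA mulrDl rpredD.
Qed.

Let D x : addmap F W := AddMap (pairingDl x).

Let D_add x y : D (x + y) = D x + D y.
Proof.
apply: addmapP => f /=; pose n := (lev x + lev y + lev (x + y))%N.
have Qq := approxQ n f; have qV := approxP n f.
rewrite (pairingE _ Qq qV) ?leq_addl // mulrDr clsD.
by rewrite -!(pairingE _ Qq qV) // /n; lia.
Qed.

Let D_const p x : Q p -> D (p * x) = p *: D x.
Proof.
move=> Qp; apply: addmapP => f /=; have [k kV] := unif_exp tP p.
pose n := (lev (p * x) + (k + lev x))%N.
have Qq := approxQ n f; have qV := approxP n f.
rewrite (pairingE _ Qq qV) ?leq_addr // (@pairingE (lev x) _ _ (p * approx n f)) //.
- by rewrite mulrA (mulrC p).
- exact: quotient_fieldM.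
have -> : (p * f - p * approx n f) / t ^+ lev x
    = t ^+ k * p * ((f - approx n f) / t ^+ (k + lev x)).
  by rewrite exprD; field; rewrite !tX0.
by rewrite rpredM // (unif_divXW tP _ qV) // leq_addl.
Qed.

(* Let q be close to f, and let p1, p2 in Q be so close to x, y that q p1 and q p2 are
   close to x f and y f. The Leibniz rule then says that q (x - p1) (y - p2) is in
   Q + A. With j and M as below, x - p1 and y - p2 are t^M times elements of V that
   t^(j+M) carries into A, and the closure of such elements under products puts
   q (x - p1) (y - p2) in A. *)
Let D_leibniz x y : D (x * y) = x *: D y + y *: D x.
Proof.
apply: addmapP => f /=.
have [k kV] := unif_exp tP x; have [l lV] := unif_exp tP y.
pose j := (lev x + lev y)%N; pose n := (lev (x * y) + (k + l + j))%N.
pose q := approx n f; have Qq : Q q := approxQ n f.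
have qV : (f - q) / t ^+ n \in V := approxP n f.
have [h hV] := unif_exp tP q; pose M := (j + h)%N.
pose p1 := approx M x; pose p2 := approx M y.
have Qp1 : Q p1 := approxQ M x; have Qp2 : Q p2 := approxQ M y.
have p1V : (x - p1) / t ^+ M \in V := approxP M x.
have p2V : (y - p2) / t ^+ M \in V := approxP M y.
have near z p i : t ^+ i * z \in V -> (z - p) / t ^+ M \in V -> (i + j <= n)%N ->
    (z * f - q * p) / t ^+ j \in V.
  move=> zV pV ijn.
  have -> : (z * f - q * p) / t ^+ j = t ^+ i * z * ((f - q) / t ^+ (i + j))
      + t ^+ h * q * ((z - p) / t ^+ M).
    by rewrite /M !exprD; field; rewrite !tX0.
  by rewrite rpredD // rpredM // (unif_divXW tP ijn).
rewrite (pairingE _ Qq qV) ?leq_addr //.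
rewrite (@pairingE j (x * f) y (q * p1)) ?leq_addl //; first last.
- by apply: (near _ _ k) => //; rewrite /n; lia.
- exact: quotient_fieldM.
rewrite (@pairingE j (y * f) x (q * p2)) ?leq_addr //; first last.
- by apply: (near _ _ l) => //; rewrite /n; lia.
- exact: quotient_fieldM.
apply/eqP; rewrite -subr_eq0 -clsD -clsN -clsD; apply/eqP; apply/cls_eq0.
exists (- (q * p1 * p2)), (q * (x - p1) * (y - p2)); split; last by ring.
  by apply: quotient_fieldN; do ?apply: quotient_fieldM.
have lowA z p : (lev z <= j)%N -> Q p -> (z - p) / t ^+ M \in V ->
    t ^+ (j + M) * ((z - p) / t ^+ M) \in A.
  move=> zj Qp pV.
  have zA : t ^+ j * z \in A.
    by rewrite -(subnK zj) exprD -mulrA rpredM // UA ?(unifX_mem tP).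
  have -> : t ^+ (j + M) * ((z - p) / t ^+ M) = t ^+ j * z - t ^+ j * p.
    by rewrite exprD; field.
  rewrite rpredB // UA //; apply: (unif_cap tP); first exact: quotient_fieldM.
  have -> : t ^+ j * p = t ^+ j * z - t ^+ (j + M) * ((z - p) / t ^+ M).
    by rewrite exprD; field.
  by apply: rpredB; [exact: AV | rewrite rpredM ?(unifX_memV tP)].
have abA := blowupA p1V p2V (lowA _ _ (leq_addr _ _) Qp1 p1V)
  (lowA _ _ (leq_addl _ _) Qp2 p2V).
have -> : q * (x - p1) * (y - p2)
    = t ^+ h * q * (t ^+ (j + M) * ((x - p1) / t ^+ M * ((y - p2) / t ^+ M))).
  by rewrite /M !exprD; field; rewrite !tX0.
by rewrite rpredM // UA //; apply: (unif_cap tP) => //; apply: quotient_fieldM.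
Qed.

Let D_derivation : derivation Q D.
Proof. by split; [exact: D_add | exact: D_leibniz | move=> q x; exact: D_const]. Qed.

Variables (Omega : lmodType F) (d : F -> Omega).
Hypothesis univ_d : universal_derivation Q d.

(** The derivation D factors through d. If d v is the sum of the a *: d r with a in V
    and r in A, then at 1 the value of D v is the sum of the values of D r at a; these
    vanish because elements of Q close to a lie in U. But D v sends 1 to the class of
    v, so v is in (Q + A) `&` V = A. *)
Lemma ring_of_Omega_of_sub : ring_of V d (Omega_of V d [set` A]) `<=` [set` A].
Proof.
move=> v [/= vV [s [sA dv]]]; have [[phi phiE] _] := univ_d.2 _ D D_derivation.
have pairA a r : a \in V -> r \in A -> pairing a r = 0.
  move=> aV rA; apply: clsA; rewrite rpredM // UA //; apply: (unif_cap tP) => //.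
  set n := lev r; rewrite -[approx n a](subKr a) rpredB // -(divfK (tX0 n) (a - _)).
  by rewrite rpredM ?(unifX_memV tP).
have : D v 1 = 0.
  rewrite -phiE dv linear_sum addmap_sum big_seq big1 // => p /sA[pV pA].
  by rewrite linearZ phiE /= mulr1 pairA.
have Q1 : Q 1 by apply: quotient_fieldW; rewrite rpred1.
have V0 : (1 - 1) / t ^+ lev v \in V by rewrite subrr mul0r rpred0.
rewrite /= (pairingE (leqnn _) Q1 V0).
rewrite mul1r => /cls_eq0[q [r [Qq rA vqr]]].
rewrite vqr rpredD // UA //; apply: (unif_cap tP) => //.
by rewrite -[q](addrK r) -vqr rpredB // AV.
Qed.

End Derivation.

(** * The correspondence *)

Section Correspondence.
Variables (F : fieldType) (U V : subringClosed F) (t : F).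
Hypothesis tP : uniformizer U V t.
Local Notation Q := (quotient_field U).
Variables (Omega : lmodType F) (d : F -> Omega).
Hypothesis univ_d : universal_derivation Q d.

(** Omega(R) = Omega would give R = V, a finitely generated module over itself. *)
Lemma Omega_of_bad_stable R : bad_stable_between V U R ->
  proper_full_submodules V Omega (Omega_of V d R) /\
  ring_of V d (Omega_of V d R) = R.
Proof.
move=> [A [-> UA AV [_ _ stA infA] normA]].
have torsA := normalization_tors tP UA normA.
have blowupA := stable_blowup tP UA AV normA stA.
have RO : ring_of V d (Omega_of V d [set` A]) = [set` A].
  apply/seteqP; split.
    exact: (ring_of_Omega_of_sub tP UA AV torsA blowupA univ_d).
  move=> r rA; split; first exact: AV.
  by rewrite /= -[d r]scale1r; apply: Omega_of_gen; rewrite ?rpred1.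
split=> //; split.
- exact: Omega_of_submodule.
- move=> OT; apply: infA; exists [:: 1].
  have VA : {subset V <= A}.
    move=> v vV; have : [set` A] v; [rewrite -RO | by []].
    by split=> //; rewrite /= OT.
  rewrite normA; apply/seteqP; split=> x /=.
    move=> /VA xA; exists (fun=> exist (fun b => b \in A) x xA).
    by rewrite big_ord1 /= mulr1.
  by move=> [a ->]; rewrite big_ord1 mulr1 AV //; exact: (valP (a _)).
move=> w; have [s ->] := differential_spanT univ_d w.
have [O0 OD OZ] := Omega_of_submodule V d [set` A].
suff [n On] : exists n,
    Omega_of V d [set` A] (t ^+ n *: \sum_(p <- s) p.1 *: d p.2).
  by exists (t ^+ n); rewrite (unifX_memV tP) (unifX_neq0 tP).
elim: s => [|[a x] s [n IH]]; first by exists 0%N; rewrite big_nil scaler0.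
have [m mA] := torsA x; have [l lV] := unif_exp tP a.
have [[_ _ dZ] _] := univ_d.
exists (n + (l + m))%N; rewrite big_cons scalerDr; apply: OD; last first.
  by rewrite addnC exprD -scalerA; apply: OZ; rewrite ?(unifX_memV tP).
rewrite exprD -scalerA; apply: OZ; first exact: (unifX_memV tP).
have -> : t ^+ (l + m) *: (a *: d x) = (t ^+ l * a) *: d (t ^+ m * x).
  rewrite dZ; last by apply: quotient_fieldW; apply: (unifX_mem tP).
  by rewrite !scalerA exprD mulrAC.
exact: Omega_of_gen.
Qed.

End Correspondence.

Theorem theorem4p1 (F : fieldType) (U V : subringClosed F)
    (Omega : lmodType F) (d : F -> Omega)
    (dvrU : dvr U) (dvrV : dvr V) (fracV : quotient_field V = setT)
    (immUV : immediate U V)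
    (univ_d : universal_derivation (quotient_field U) d) :
  [/\ set_bij (bad_stable_between V U) (proper_full_submodules V Omega)
        (Omega_of V d),
      set_bij (proper_full_submodules V Omega) (bad_stable_between V U)
        (ring_of V d),
      {in bad_stable_between V U, cancel (Omega_of V d) (ring_of V d)}
    & {in proper_full_submodules V Omega,
        cancel (ring_of V d) (Omega_of V d)}].
Proof.
have [t tP] := immediate_uniformizer dvrU dvrV fracV immUV.
have OmegaP R : bad_stable_between V U R ->
    proper_full_submodules V Omega (Omega_of V d R).
  by move=> /(Omega_of_bad_stable tP univ_d)[].
have ringK R : bad_stable_between V U R -> ring_of V d (Omega_of V d R) = R.
  by move=> /(Omega_of_bad_stable tP univ_d)[].
have ringP K : proper_full_submodules V Omega K ->
    bad_stable_between V U (ring_of V d K).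
  exact: (ring_of_bad_stable tP univ_d).
have OmegaK K : proper_full_submodules V Omega K ->
    Omega_of V d (ring_of V d K) = K.
  by move=> [subK _ fullK]; apply: (Omega_of_ring_of tP univ_d).
have ringK' : {in bad_stable_between V U, cancel (Omega_of V d) (ring_of V d)}.
  by move=> R; rewrite inE; apply: ringK.
have OmegaK' : {in proper_full_submodules V Omega,
    cancel (ring_of V d) (Omega_of V d)}.
  by move=> K; rewrite inE; apply: OmegaK.
split=> //; split=> //.
- exact: can_in_inj ringK'.
- by move=> K PK; exists (ring_of V d K); [exact: ringP | exact: OmegaK].
- exact: can_in_inj OmegaK'.
by move=> R PR; exists (Omega_of V d R); [exact: OmegaP | exact: ringK].
Qed.
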